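(* Let $N\ge2$, let $\Sigma\subset\mathbb{C}^N$ be compact, and let $k$ be an integer with $2\le k\le N$. If $K\subset\widehat{\Sigma}^{\,k}$ is a compact polynomially convex set, and if the set of (restrictions to $\Sigma$ of) polynomials that have no zeros on $K$ is dense in $P(\Sigma)$, then there is a compact subset $X$ of $\Sigma$ such that $h_r^{k-1}(X)\supset K$ and $P(X)$ has dense invertibles.
   Context: Let $X\subset\mathbb{C}^N$ be compact. An analytic subvariety of $\mathbb{C}^N$ of pure codimension $m$ means a pure-dimensional analytic subvariety of $\mathbb{C}^N$ of dimension $N-m$. The polynomial hull is $\widehat{X}=\{z: |p(z)|\le\max_X|p| \text{ for all polynomials } p\}$; $X$ is polynomially convex if $\widehat X=X$. For $1\le k\le N$, the $k$-rational hull $h_r^k(X)$ is the set of $z\in\mathbb{C}^N$ such that every analytic subvariety of $\mathbb{C}^N$ of pure codimension $\le k$ that passes through $z$ intersects $X$. For $2\le k\le N$ the $k$-polynomial hull $\widehat{X}^{\,k}$ is the set of $z\in\mathbb{C}^N$ such that $z\in h_r^{k-1}(X)$ and $z\in\widehat{X\cap V}$ for every analytic subvariety $V$ of $\mathbb{C}^N$ of pure codimension $\le k-1$ passing through $z$. $P(X)$ is the uniform closure on $X$ of the polynomials in the coordinate functions. A uniform algebra has dense invertibles if its invertible elements are dense in it. *)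

(* Defs.v *)
(* C := R[i] (complex numbers over a
   realType R, from mathcomp-real-closed), C^N := 'rV[C]_N with its standard
   (product/normed) topology; complex differentiability is taken with respect
   to scalars in C, so "differentiable" below means holomorphic. *)
From HB Require Import structures.
From mathcomp Require Import all_boot all_order all_algebra.
From mathcomp Require Import all_classical all_reals all_analysis.
From mathcomp Require Import complex.
Import Order.TTheory GRing.Theory Num.Theory.
Import numFieldNormedType.Exports.
Set Implicit Arguments. Unset Strict Implicit. Unset Printing Implicit Defensive.
Local Open Scope ring_scope.
Local Open Scope classical_set_scope.
Local Open Scope complex_scope.

Definition CC (R : realType) := (R[i])^o.
Definition Cn (R : realType) (N : nat) := 'rV[CC R]_N.

Inductive is_poly (R : realType) (N : nat) : (Cn R N -> CC R) -> Prop :=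
| poly_const (c : CC R) : is_poly (fun _ => c)
| poly_coord (i : 'I_N) : is_poly (fun z : Cn R N => z ord0 i)
| poly_add (p q : Cn R N -> CC R) :
    is_poly p -> is_poly q -> is_poly (fun z => p z + q z)
| poly_mul (p q : Cn R N -> CC R) :
    is_poly p -> is_poly q -> is_poly (fun z => p z * q z).

Definition holo_on (R : realType) (N : nat) (U : set (Cn R N))
    (f : Cn R N -> CC R) : Prop :=
  forall x, U x -> differentiable f x.

Definition analytic_subvariety (R : realType) (N : nat) (V : set (Cn R N)) : Prop :=
  closed V /\
  forall p : Cn R N, exists U : set (Cn R N), open U /\ U p /\
    exists (r : nat) (f : 'I_r -> Cn R N -> CC R),
      (forall i, holo_on U (f i)) /\
      V `&` U = [set z | U z /\ forall i, f i z = 0].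

Definition regular_point_codim (R : realType) (N : nat) (V : set (Cn R N))
    (m : nat) (p : Cn R N) : Prop :=
  V p /\
  exists U : set (Cn R N), open U /\ U p /\
    exists f : 'I_m -> Cn R N -> CC R,
      (forall i, holo_on U (f i)) /\
      V `&` U = [set z | U z /\ forall i, f i z = 0] /\
      (forall c : 'I_m -> CC R,
         (forall v : Cn R N, \sum_(i < m) c i * 'd (f i) p v = 0) ->
         forall i, c i = 0).

(* analytic subvariety of pure codimension m (pure dimension N - m): every
   regular point has codimension m (regular points are dense in V) *)
Definition pure_codim (R : realType) (N : nat) (V : set (Cn R N)) (m : nat) : Prop :=
  analytic_subvariety V /\
  forall (m' : nat) (p : Cn R N), regular_point_codim V m' p -> m' = m.

(* polynomial hull.  For compact X, max_X |q| is attained, so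
   |q z| <= max_X |q|  iff  |q z| <= |q x| for some x in X. *)
Definition phull (R : realType) (N : nat) (X : set (Cn R N)) : set (Cn R N) :=
  [set z | forall q : Cn R N -> CC R, is_poly q ->
             exists2 x, X x & `|q z| <= `|q x|].

Definition rhull (R : realType) (N : nat) (k : nat) (X : set (Cn R N)) : set (Cn R N) :=
  [set z | forall (m : nat) (V : set (Cn R N)),
             (1 <= m <= k)%N -> pure_codim V m -> V z ->
             exists x, X x /\ V x].

Definition khull (R : realType) (N : nat) (k : nat) (X : set (Cn R N)) : set (Cn R N) :=
  [set z | rhull k.-1 X z /\
           forall (m : nat) (V : set (Cn R N)),
             (1 <= m <= k.-1)%N -> pure_codim V m -> V z ->
             phull (X `&` V) z].

Definition inPX (R : realType) (N : nat) (X : set (Cn R N)) (f : Cn R N -> CC R) : Prop :=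
  forall e : R, 0 < e -> exists q, is_poly q /\
    forall x, X x -> `|f x - q x| < e%:C.

Definition invertible_PX (R : realType) (N : nat) (X : set (Cn R N))
    (f : Cn R N -> CC R) : Prop :=
  inPX X f /\ exists g, inPX X g /\ forall x, X x -> f x * g x = 1.

Definition dense_invertibles (R : realType) (N : nat) (X : set (Cn R N)) : Prop :=
  forall f, inPX X f -> forall e : R, 0 < e ->
    exists h, invertible_PX X h /\ forall x, X x -> `|f x - h x| < e%:C.

(* Main.v *)
(**
  A polynomial p without zeros on K is invertible in P(K), K being polynomially
  convex. Enumerate a sequence p_0, p_1, ... of polynomials without zeros on K
  that is dense in P(Sigma). Construct polynomials H_n with Re H_n >= 3/4 on K
  such that p_n divides H_{n+1} and the sets X_n = {x in Sigma, Re H_n(x) >= 1/2}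
  decrease: if q is close to 1/p_n on K and phi is a polynomial in H_n (up to a
  small error) that is close to 1 on K and very small on Sigma minus X_n, take
  H_{n+1} = phi p_n q. Let X be the intersection of the X_n.

  Each p_n is invertible in P(X), since it divides H_{n+1} and Re H_{n+1} >= 1/2
  on X. If V is a subvariety through z in K, then z is in the polynomial hull of
  the intersection of Sigma and V; as Re H_n(z) > 1/2, the polynomial H_n + L
  with L large forces Re H_n >= 1/2 somewhere on that intersection. So V meets
  every X_n, and by compactness it meets X.

  The invertibility of p in P(K) is Gelfand theory made finite: a proper ideal
  containing p is enlarged by z_1 - a_1, ..., z_N - a_N, keeping it proper, and
  a is then a zero of p in the polynomial hull of K. That a suitable a_i exists
  is the non-emptiness of the spectrum in the quotient algebra, obtained from
  the maximum principle for the quotient norm of the resolvent.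
*)

Require Import Defs.
From HB Require Import structures.
From mathcomp Require Import all_boot all_order all_algebra.
From mathcomp Require Import all_classical all_reals all_analysis.
From mathcomp Require Import complex ring lra.
Import Order.TTheory GRing.Theory Num.Theory.
Import numFieldNormedType.Exports.
Local Open Scope ring_scope.
Local Open Scope classical_set_scope.
Local Open Scope complex_scope.

Set Implicit Arguments.
Unset Strict Implicit.
Unset Printing Implicit Defensive.

(** * Modulus of complex numbers *)

(** The norm of [CC R] takes its values in [R[i]]; this is the same modulus as an element of [R],
    where real order arguments apply. *)
Definition cabs {R : realType} (z : CC R) : R := complex.Re `|z|.

Lemma normr_cabs (R : realType) (z : CC R) : `|z| = (cabs z)%:C.
Proof. by rewrite /cabs RRe_real // ger0_real. Qed.

Lemma cabs_lt (R : realType) (z : CC R) (e : R) : (`|z| < e%:C) = (cabs z < e).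
Proof. by rewrite normr_cabs ltcR. Qed.

Lemma cabs_le (R : realType) (z w : CC R) : (`|z| <= `|w|) = (cabs z <= cabs w).
Proof. by rewrite !normr_cabs lecR. Qed.

Lemma cabs_ge0 (R : realType) (z : CC R) : 0 <= cabs z.
Proof. by rewrite -ler0c -normr_cabs. Qed.

Lemma cabsD (R : realType) (z w : CC R) : cabs (z + w) <= cabs z + cabs w.
Proof. by rewrite -lecR rmorphD /= -!normr_cabs ler_normD. Qed.

Lemma cabsM (R : realType) (z w : CC R) : cabs (z * w) = cabs z * cabs w.
Proof. by apply: complexI; rewrite rmorphM /= -!normr_cabs normrM. Qed.

Lemma cabsN (R : realType) (z : CC R) : cabs (- z) = cabs z.
Proof. by rewrite /cabs normrN. Qed.

Lemma cabsBC (R : realType) (z w : CC R) : cabs (z - w) = cabs (w - z).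
Proof. by rewrite -cabsN opprB. Qed.

Lemma cabsB (R : realType) (z w : CC R) : cabs (z - w) <= cabs z + cabs w.
Proof. by rewrite -(cabsN w) cabsD. Qed.

Lemma cabs0 (R : realType) : cabs (0 : CC R) = 0.
Proof. by apply: complexI; rewrite -normr_cabs normr0. Qed.

Lemma cabs1 (R : realType) : cabs (1 : CC R) = 1.
Proof. by apply: complexI; rewrite -normr_cabs normr1. Qed.

Lemma cabsX (R : realType) (z : CC R) n : cabs (z ^+ n) = cabs z ^+ n.
Proof.
by elim: n => [|n IH]; rewrite ?expr0 ?cabs1 // !exprS cabsM IH.
Qed.

Lemma cabs_eq0 (R : realType) (z : CC R) : (cabs z == 0) = (z == 0).
Proof. by rewrite -(normr_eq0 z) normr_cabs (inj_eq (@complexI R) _ 0). Qed.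

Lemma cabs_gt0 (R : realType) (z : CC R) : (0 < cabs z) = (z != 0).
Proof. by rewrite lt_def cabs_eq0 cabs_ge0 andbT. Qed.

Lemma cabsV (R : realType) (z : CC R) : cabs z^-1 = (cabs z)^-1.
Proof.
have [->|z0] := eqVneq z 0; first by rewrite invr0 cabs0 invr0.
have h := cabs_eq0 z; rewrite (negbTE z0) in h.
apply: (mulfI (negbT h)).
by rewrite -cabsM !mulfV ?h // cabs1.
Qed.

Lemma cabsR (R : realType) (x : R) : cabs (x%:C : CC R) = `|x|.
Proof. by rewrite /cabs normc_def /= expr0n addr0 sqrtr_sqr. Qed.

Lemma cabsi (R : realType) : cabs ('i : CC R) = 1.
Proof. by rewrite /cabs normc_def /= expr0n add0r expr1n sqrtr1. Qed.

Lemma sqr_cabs (R : realType) (z : CC R) :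
  cabs z ^+ 2 = complex.Re z ^+ 2 + complex.Im z ^+ 2.
Proof. by apply: complexI; rewrite rmorphXn /= -normr_cabs add_Re2_Im2. Qed.

Lemma Re_cabs (R : realType) (z : CC R) : `|complex.Re z| <= cabs z.
Proof. by rewrite -lecR -normr_cabs normc_ge_Re. Qed.

Lemma ReD (R : realType) (z w : CC R) :
  complex.Re (z + w) = complex.Re z + complex.Re w.
Proof. by case: z w => [a b] [c d]. Qed.

Lemma ReN (R : realType) (z : CC R) : complex.Re (- z) = - complex.Re z.
Proof. by case: z. Qed.

(** The cross term dominates for large [a], so that comparing moduli of translates amounts to
    comparing real parts. *)
Lemma sqr_cabs_addR (R : realType) (z : CC R) (a : R) :
  cabs (z + a%:C) ^+ 2 = cabs z ^+ 2 + 2 * a * complex.Re z + a ^+ 2.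
Proof. by rewrite !sqr_cabs; case: z => x y /=; ring. Qed.

(** * Continuity and bounds of polynomials on compact sets *)

Lemma is_poly_continuous (R : realType) N (q : Cn R N -> CC R) :
  is_poly q -> continuous q.
Proof.
elim=> [c|i|p {}q _ cp _ cq|p {}q _ cp _ cq] x.
- exact: cst_continuous.
- exact: coord_continuous.
- by apply: continuousD; [exact: cp|exact: cq].
- by apply: continuousM; [exact: cp|exact: cq].
Qed.

Lemma continuous_real_comp (R : realType) (T : topologicalType)
    (g : T -> CC R) (u : CC R -> R) :
  continuous g -> (forall a b, `|u a - u b| <= cabs (a - b)) ->
  continuous (fun x => u (g x)).
Proof.
move=> cg hu x; apply/cvgrPdist_lt => e e0.
have e0' : 0 < (e%:C : CC R) by rewrite ltcR.
have /cvgrPdist_lt/(_ _ e0') := cg x.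
by apply: filterS => y; rewrite cabs_lt; exact: le_lt_trans.
Qed.

Lemma continuous_cabs (R : realType) (T : topologicalType) (g : T -> CC R) :
  continuous g -> continuous (fun x => cabs (g x)).
Proof.
move=> cg; apply: continuous_real_comp => // a b.
have h1 := cabsD (a - b) b; have h2 := cabsD (b - a) a.
move: h1 h2; rewrite !subrK (cabsBC b) => h1 h2.
by rewrite ler_norml; apply/andP; split; lra.
Qed.

Lemma continuous_Re (R : realType) (T : topologicalType) (g : T -> CC R) :
  continuous g -> continuous (fun x => complex.Re (g x)).
Proof.
move=> cg; apply: continuous_real_comp => // a b.
by rewrite -ReN -ReD Re_cabs.
Qed.

Lemma compact_ubound (R : realType) (T : topologicalType) (Y : set T)
    (f : T -> R) : compact Y -> continuous f ->
  exists2 M, 0 <= M & forall x, Y x -> f x <= M.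
Proof.
move=> cY cf; have [->|/set0P[y Yy]] := eqVneq Y set0; first by exists 0.
have [|c _ hc] := compact_EVT_max (ex_intro _ y Yy) cY (f := f).
  exact: continuous_subspaceT.
exists `|f c|; first by rewrite normr_ge0.
by move=> x Yx; apply: le_trans (ler_norm _); apply: hc; rewrite inE.
Qed.

Lemma is_poly_bounded (R : realType) N (Y : set (Cn R N)) q :
  compact Y -> is_poly q ->
  exists2 M, 0 <= M & forall x, Y x -> cabs (q x) <= M.
Proof.
by move=> cY /is_poly_continuous/continuous_cabs; exact: compact_ubound.
Qed.

(** * The uniform algebra P(Y) *)

Lemma inPX_bounded (R : realType) N (Y : set (Cn R N)) f :
  compact Y -> inPX Y f ->
  exists2 M, 0 <= M & forall x, Y x -> cabs (f x) <= M.
Proof.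
move=> cY /(_ 1 ltr01)[q [pq hq]]; have [M M0 hM] := is_poly_bounded cY pq.
exists (M + 1) => [|x Yx]; first by rewrite addr_ge0.
have := hq x Yx; rewrite cabs_lt => h1; have h2 := hM x Yx.
by have := cabsD (q x) (f x - q x); rewrite addrC subrK; lra.
Qed.

Lemma inPX_poly (R : realType) N (Y : set (Cn R N)) q : is_poly q -> inPX Y q.
Proof. by move=> pq e e0; exists q; split=> // x _; rewrite subrr normr0 ltcR. Qed.

Lemma inPX_cst (R : realType) N (Y : set (Cn R N)) (c : CC R) :
  inPX Y (fun=> c).
Proof. exact/inPX_poly/poly_const. Qed.

Lemma inPX_lim (R : realType) N (Y : set (Cn R N)) f :
  (forall e : R, 0 < e ->
    exists2 g, inPX Y g & forall x, Y x -> cabs (f x - g x) <= e) ->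
  inPX Y f.
Proof.
move=> h e e0; have e2 : 0 < e / 2 by lra.
have [g /(_ _ e2)[q [pq hq]] hg] := h _ e2; exists q; split=> // x Yx.
rewrite cabs_lt; have := hq x Yx; rewrite cabs_lt => h1; have := hg x Yx => h2.
by have := cabsD (f x - g x) (g x - q x); rewrite addrA subrK; lra.
Qed.

Lemma inPX_ext (R : realType) N (Y : set (Cn R N)) f g :
  inPX Y f -> (forall x, Y x -> f x = g x) -> inPX Y g.
Proof.
by move=> hf fg e /hf[q [pq hq]]; exists q; split=> // x Yx; rewrite -fg ?hq.
Qed.

Lemma inPXD (R : realType) N (Y : set (Cn R N)) f g :
  inPX Y f -> inPX Y g -> inPX Y (fun x => f x + g x).
Proof.
move=> hf hg e e0; have e2 : 0 < e / 2 by lra.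
have [p [pp hp]] := hf _ e2; have [q [pq hq]] := hg _ e2.
exists (fun x => p x + q x); split; first exact: poly_add.
move=> x Yx; have := hp x Yx; have := hq x Yx; rewrite !cabs_lt => h1 h2.
have -> : f x + g x - (p x + q x) = (f x - p x) + (g x - q x) by ring.
by have := cabsD (f x - p x) (g x - q x); lra.
Qed.

(** With [d <= 1] the approximant [q] has modulus at most [B + 1], so [u * (v - q) + (u - p) * q]
    has modulus at most [d * (A + B + 1)]. *)
Lemma cabs_mul_approx (R : realType) (A B e : R) : 0 <= A -> 0 <= B -> 0 < e ->
  exists2 d, 0 < d & forall u v p q : CC R, cabs u <= A -> cabs v <= B ->
    cabs (u - p) <= d -> cabs (v - q) <= d -> cabs (u * v - p * q) <= e.
Proof.
move=> A0 B0 e0; pose d := Num.min 1 (e / (A + B + 1)).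
have d0 : 0 < d by rewrite lt_min ltr01 divr_gt0 //; lra.
have d1 : d <= 1 by rewrite ge_min lexx.
have d2 : d * (A + B + 1) <= e.
  by rewrite -ler_pdivlMr ?ge_min ?lexx ?orbT //; lra.
exists d => // u v p q uA vB up vq.
have -> : u * v - p * q = u * (v - q) + (u - p) * (v - (v - q)) by ring.
apply: le_trans (cabsD _ _) _; rewrite !cabsM.
have h1 : cabs u * cabs (v - q) <= A * d by rewrite ler_pM ?cabs_ge0.
have h2 : cabs (u - p) * cabs (v - (v - q)) <= d * (B + 1).
  rewrite ler_pM ?cabs_ge0 //; apply: le_trans (cabsB _ _) _.
  by rewrite lerD // (le_trans vq).
by nra.
Qed.

Lemma inPXM (R : realType) N (Y : set (Cn R N)) f g : compact Y ->
  inPX Y f -> inPX Y g -> inPX Y (fun x => f x * g x).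
Proof.
move=> cY hf hg; have [A A0 hA] := inPX_bounded cY hf.
have [B B0 hB] := inPX_bounded cY hg.
apply: inPX_lim => e e0; have [d d0 hd] := cabs_mul_approx A0 B0 e0.
have [p [pp hp]] := hf _ d0; have [q [pq hq]] := hg _ d0.
exists (fun x => p x * q x); first exact/inPX_poly/poly_mul.
move=> x Yx; have := hp x Yx; have := hq x Yx; rewrite !cabs_lt => /ltW h1 /ltW h2.
by apply: hd => //; [exact: hA|exact: hB].
Qed.

Lemma inPXN (R : realType) N (Y : set (Cn R N)) f :
  inPX Y f -> inPX Y (fun x => - f x).
Proof.
move=> hf e /hf[q [pq hq]]; exists (fun x => -1 * q x); split.
  by apply: poly_mul => //; exact: poly_const.
by move=> x Yx; rewrite mulN1r -opprD normrN hq.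
Qed.

Lemma inPXB (R : realType) N (Y : set (Cn R N)) f g :
  inPX Y f -> inPX Y g -> inPX Y (fun x => f x - g x).
Proof. by move=> hf /inPXN; exact: inPXD. Qed.

Lemma inPX_exp (R : realType) N (Y : set (Cn R N)) f n : compact Y ->
  inPX Y f -> inPX Y (fun x => f x ^+ n).
Proof.
move=> cY hf; elim: n => [|n IH]; first exact: inPX_cst.
by apply: inPX_ext (inPXM cY hf IH) _ => x _; rewrite exprS.
Qed.

Lemma inPX_sum (R : realType) N (Y : set (Cn R N)) (F : nat -> Cn R N -> CC R) n :
  (forall k, inPX Y (F k)) -> inPX Y (fun x => \sum_(k < n) F k x).
Proof.
move=> hF; elim: n => [|n IH].
  by apply: inPX_ext (inPX_cst Y 0) _ => x _; rewrite big_ord0.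
by apply: inPX_ext (inPXD IH (hF n)) _ => x _; rewrite big_ord_recr.
Qed.

(** * Inverses in P(Y) *)

Lemma expr_small (R : realType) (r d : R) : 0 <= r < 1 -> 0 < d ->
  exists n, r ^+ n < d.
Proof.
move=> /andP[r0 r1] d0; have r1' : `|r| < 1 by rewrite ger0_norm.
have /cvgrPdist_lt/(_ _ d0)[n _ /(_ n (leqnn n))] := cvg_expr r1'.
by rewrite sub0r normrN ger0_norm ?exprn_ge0 // => h; exists n.
Qed.

(** Neumann series: the partial sums of the powers of [1 - u] differ from [1/u] by [(1 - u)^n / u],
    and [|u| >= 1 - r]. *)
Lemma inPXV_near1 (R : realType) N (Y : set (Cn R N)) u (r : R) : compact Y ->
  r < 1 -> inPX Y u -> (forall x, Y x -> cabs (1 - u x) <= r) ->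
  inPX Y (fun x => (u x)^-1).
Proof.
move=> cY r1 hu hr.
have [->|/set0P[y Yy]] := eqVneq Y set0; first
  by move=> e _; exists (fun=> 0); split=> //; exact: poly_const.
have r0 : 0 <= r by apply: le_trans (hr y Yy); exact: cabs_ge0.
apply: inPX_lim => e e0.
have d0 : 0 < e * (1 - r) by rewrite mulr_gt0 ?subr_gt0.
have [|n hn] := @expr_small R r _ _ d0; first by rewrite r0.
exists (fun x => \sum_(k < n) (1 - u x) ^+ k).
  apply: (@inPX_sum _ _ _ (fun k x => (1 - u x) ^+ k)) => k.
  by apply: inPX_exp => //; apply: inPXB => //; exact: inPX_cst.
move=> x Yx; have h := hr x Yx.
have hu1 : 1 - r <= cabs (u x).
  by have := cabsD (1 - u x) (u x); rewrite subrK cabs1; lra.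
have u0 : u x != 0 by rewrite -cabs_gt0; apply: lt_le_trans hu1; rewrite subr_gt0.
have -> : (u x)^-1 - \sum_(k < n) (1 - u x) ^+ k = (1 - u x) ^+ n / u x.
  apply: (mulfI u0); rewrite mulrBr mulrCA !mulfV // mulr1.
  have := subrX1 (1 - u x) n.
  rewrite (_ : 1 - u x - 1 = - u x); last by ring.
  by rewrite mulNr => h'; rewrite -[LHS]addrC -h' subrK.
rewrite cabsM cabsV cabsX ler_pdivrMr ?cabs_gt0 //.
apply: (@le_trans _ _ (e * (1 - r))); last by rewrite ler_pM2l.
by apply: le_trans (ltW hn); rewrite lerXn2r ?nnegrE ?cabs_ge0.
Qed.

(** The quotient [g / f] is within [r] of 1, hence inverted by the Neumann series; [1/g] is that
    inverse times [1/f]. *)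
Lemma inPXV_near (R : realType) N (Y : set (Cn R N)) f g (r : R) : compact Y ->
  r < 1 -> inPX Y f -> inPX Y g -> inPX Y (fun x => (f x)^-1) ->
  (forall x, Y x -> f x != 0 /\ cabs (f x - g x) <= r * cabs (f x)) ->
  inPX Y (fun x => (g x)^-1).
Proof.
move=> cY r1 hf hg hVf hr.
have hu : inPX Y (fun x => g x * (f x)^-1) by exact: inPXM.
have hVu : inPX Y (fun x => (g x * (f x)^-1)^-1).
  apply: (inPXV_near1 cY r1 hu) => x /hr[f0 h].
  rewrite -[X in X - _](mulfV f0) -mulrBl cabsM cabsV.
  by rewrite ler_pdivrMr ?cabs_gt0.
apply: inPX_ext (inPXM cY hVu hVf) _ => x /hr[f0 _].
by rewrite invfM invrK -mulrA mulfV // mulr1.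
Qed.

(* 1/(f + is) belongs to P(Y) for large s, and the property propagates down to
   s = 0 in steps of eta/2 because |f + is| >= |Re f| >= eta. *)
Lemma inPXV_strip (R : realType) N (Y : set (Cn R N)) f (eta : R) : compact Y ->
  0 < eta -> inPX Y f -> (forall x, Y x -> eta <= `|complex.Re (f x)|) ->
  inPX Y (fun x => (f x)^-1).
Proof.
move=> cY eta0 hf hre; have [M M0 hM] := inPX_bounded cY hf.
pose c n : CC R := ((n%:R * (eta / 2))%:C * 'i)%R.
have hc n : inPX Y (fun x => f x + c n) by apply: inPXD => //; exact: inPX_cst.
have cabsc n : cabs (c n) = n%:R * (eta / 2).
  by rewrite cabsM cabsR cabsi mulr1 ger0_norm // mulr_ge0 // divr_ge0 // ltW.
have Rec n z : complex.Re (z + c n) = complex.Re z.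
  by rewrite ReD /c; case: z => a b /=; ring.
have lb n x : Y x -> eta <= cabs (f x + c n).
  by move=> Yx; apply: le_trans (Re_cabs _); rewrite Rec hre.
have step n : inPX Y (fun x => (f x + c n.+1)^-1) -> inPX Y (fun x => (f x + c n)^-1).
  move=> h; apply: (@inPXV_near _ _ _ _ _ (1 / 2) cY _ (hc n.+1) (hc n) h); first by lra.
  move=> x Yx; have h1 := lb n.+1 x Yx; split.
    by rewrite -cabs_gt0; apply: lt_le_trans h1.
  have -> : f x + c n.+1 - (f x + c n) = c 1%N.
    by rewrite /c -natr1 rmorphM /= rmorphD !rmorphM /=; ring.
  by rewrite cabsc mul1r; lra.
suff [n hn] : exists n, inPX Y (fun x => (f x + c n)^-1).
  have h0 : inPX Y (fun x => (f x + c 0%N)^-1) by elim: n hn => // n IH /step.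
  by apply: inPX_ext h0 _ => x _; rewrite /c mul0r mul0r addr0.
(* Far from 0 the constant [c n] is the invertible function to start from, as
   [|f| <= M < |c n| / 2]. *)
have [n hn] : exists n : nat, 2 * (M + 1) < n%:R * (eta / 2).
  exists (Num.trunc (2 * (M + 1) / (eta / 2))).+1.
  by rewrite -ltr_pdivrMr ?divr_gt0 // truncnS_gt.
exists n; have cn0 : c n != 0 by rewrite -cabs_gt0 cabsc; lra.
apply: (@inPXV_near _ _ _ (fun=> c n) _ (1 / 2) cY) => //; first by lra.
- exact: inPX_cst.
- exact: inPX_cst.
- move=> x Yx; split=> //.
  by rewrite opprD addrCA subrr addr0 cabsN cabsc; have := hM x Yx; lra.
Qed.

(** * Newton iteration for the sign function *)

(** The hypothesis places [s] in an Apollonius disc inside the right half-plane. The real part is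
    bounded through [|1 + s|^2 - |1 - s|^2 = 4 Re s] and [|1 + s| >= 1]; the last bound, from
    [|1 + s| <= 2 + |1 - s|], makes the disc shrink to 1 as [r] tends to 0. *)
Lemma cabs_near1 (R : realType) (s : CC R) (r : R) : 0 <= r < 1 ->
  cabs (1 - s) <= r * cabs (1 + s) ->
  [/\ (1 - r ^+ 2) / 4 <= complex.Re s, s != 0 & cabs (1 - s) * (1 - r) <= 2 * r].
Proof.
move=> /andP[r0 r1] h.
have a0 := cabs_ge0 (1 - s); have b0 := cabs_ge0 (1 + s).
have h1 : 1 <= cabs (1 + s).
  have := cabsD (1 - s) (1 + s).
  rewrite (_ : 1 - s + (1 + s) = (2 : R)%:C); last by rewrite rmorph_nat; ring.
  by rewrite cabsR ger0_norm //; nra.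
have hR : (1 - r ^+ 2) / 4 <= complex.Re s.
  have : cabs (1 - s) ^+ 2 <= r ^+ 2 * cabs (1 + s) ^+ 2.
    by rewrite -exprMn lerXn2r ?nnegrE // mulr_ge0.
  have -> : cabs (1 - s) ^+ 2 = cabs (1 + s) ^+ 2 - 4 * complex.Re s.
    by rewrite !sqr_cabs; case: (s) => x y /=; ring.
  have : (1 - r ^+ 2) * 1 <= (1 - r ^+ 2) * cabs (1 + s) ^+ 2.
    by rewrite ler_wpM2l; nra.
  by lra.
split=> //.
- apply/eqP => s0; rewrite s0 /= in hR.
  have p0 : 0 < (1 - r ^+ 2) / 4 by nra.
  by lra.
- have := cabsD (- (1 - s)) (2 : R)%:C.
  rewrite (_ : - (1 - s) + (2 : R)%:C = 1 + s); last by rewrite rmorph_nat; ring.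
  by rewrite cabsN cabsR ger0_norm //; nra.
Qed.

Lemma cabs_newton (R : realType) (s : CC R) (r : R) : s != 0 ->
  cabs (1 - s) <= r * cabs (1 + s) ->
  cabs (1 - (s + s^-1) / 2) <= r ^+ 2 * cabs (1 + (s + s^-1) / 2).
Proof.
move=> s0 h.
have -> : 1 - (s + s^-1) / 2 = - ((1 - s) ^+ 2 / (2 * s)) by field.
have -> : 1 + (s + s^-1) / 2 = (1 + s) ^+ 2 / (2 * s) by field.
rewrite cabsN !cabsM mulrA; apply: ler_wpM2r; first exact: cabs_ge0.
have := cabs_ge0 (1 - s).
have := cabs_ge0 (1 + s); rewrite -!expr2 -exprMn => *.
rewrite lerXn2r ?nnegrE //; exact: le_trans h.
Qed.

(* Newton's iteration s <- (s + 1/s)/2 for the sign function squares the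
   quotient (1 - s)/(1 + s) at every step. *)
Lemma inPX_sign (R : realType) N (Y : set (Cn R N)) h (eta d : R) : compact Y ->
  0 < eta -> 0 < d -> inPX Y h -> (forall x, Y x -> eta <= `|complex.Re (h x)|) ->
  exists2 s, inPX Y s & forall x, Y x ->
    (0 < complex.Re (h x) -> cabs (1 - s x) <= d) /\
    (complex.Re (h x) < 0 -> cabs (1 + s x) <= d).
Proof.
move=> cY eta0 d0 hh hre; have [M M0 hM] := inPX_bounded cY hh.
(* Invariant of the iteration: [s] lies in the Apollonius disc around 1 where [Re h > 0], and [-s]
   does where [Re h < 0]. *)
pose Q (s : Cn R N -> CC R) (r : R) := inPX Y s /\ forall x, Y x ->
  (0 < complex.Re (h x) -> cabs (1 - s x) <= r * cabs (1 + s x)) /\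
  (complex.Re (h x) < 0 -> cabs (1 + s x) <= r * cabs (1 - s x)).
have dich x : Y x -> (0 < complex.Re (h x)) || (complex.Re (h x) < 0).
  move=> Yx; rewrite orbC -neq_lt; apply/eqP => h0.
  by have := hre x Yx; rewrite h0 normr0; lra.
have QN s r x : Q s r -> Y x -> complex.Re (h x) < 0 ->
    cabs (1 - - s x) <= r * cabs (1 + - s x).
  by move=> [_ hs] Yx hx; rewrite opprK; exact: (hs x Yx).2.
have Qs s r : 0 <= r < 1 -> Q s r -> exists s', Q s' (r ^+ 2).
  move=> r01 hQ; have [hs hx] := hQ.
  (* [cabs_near1] keeps [Re s] at distance at least [(1 - r^2)/4] from 0, so the strip lemma inverts
     [s]. *)
  have hV : inPX Y (fun x => (s x)^-1).
    apply: (@inPXV_strip _ _ _ _ ((1 - r ^+ 2) / 4) cY) => //; first by nra.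
    move=> x Yx; case/orP: (dich x Yx) => h0.
      by have [hR _ _] := cabs_near1 r01 ((hx x Yx).1 h0); apply: le_trans (ler_norm _).
    have [hR _ _] := cabs_near1 r01 (QN _ _ _ hQ Yx h0).
    by rewrite -normrN -ReN; apply: le_trans (ler_norm _).
  exists (fun x => (s x + (s x)^-1) / 2); split.
    by apply: inPXM => //; [exact: inPXD|exact: inPX_cst].
  move=> x Yx; split=> h0.
    have h1 := (hx x Yx).1 h0; have [_ s0 _] := cabs_near1 r01 h1.
    exact: cabs_newton.
  have h1 := QN _ _ _ hQ Yx h0; have [_ s0 _] := cabs_near1 r01 h1.
  by have := cabs_newton s0 h1; rewrite invrN -opprD mulNr opprK.
(* The iteration starts at [h] with ratio [r = 1 - t]. As [1 - r^2 <= 2t] and [|1 + z| <= 1 + M],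
   this [t] gives [(1 - r^2) |1 + z|^2 <= m <= eta <= 4 Re z]. The cap [m <= 1] keeps [r]
   nonnegative. *)
pose m := Num.min eta 1.
have m0 : 0 < m by rewrite lt_min eta0 ltr01.
have m1 : m <= 1 by rewrite ge_min lexx orbT.
have me : m <= eta by rewrite ge_min lexx.
have M1 : 1 <= (1 + M) ^+ 2 by nra.
have [t [t0 tM]] : exists t : R, 0 < t /\ t * (1 + M) ^+ 2 = m / 2.
  exists (m / 2 / (1 + M) ^+ 2); split; first by rewrite !divr_gt0 //; lra.
  by rewrite mulfVK //; apply: lt0r_neq0; lra.
have t1 : t <= 1 / 2 by nra.
have [r rt] : exists r, r = 1 - t by exists (1 - t).
have r0 : 0 <= r by lra.
have r1 : r < 1 by lra.
have r01 : 0 <= r < 1 by rewrite r0.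
have base z : cabs z <= M -> eta <= complex.Re z -> cabs (1 - z) <= r * cabs (1 + z).
  move=> zM ez; rewrite -(@ler_pXn2r _ 2%N) ?nnegrE ?mulr_ge0 ?cabs_ge0 //.
  rewrite exprMn.
  have -> : cabs (1 - z) ^+ 2 = cabs (1 + z) ^+ 2 - 4 * complex.Re z.
    by rewrite !sqr_cabs; case: (z) => x y /=; ring.
  have : cabs (1 + z) ^+ 2 <= (1 + M) ^+ 2.
    rewrite lerXn2r ?nnegrE ?cabs_ge0 //; first by lra.
    by apply: le_trans (cabsD _ _) _; rewrite cabs1; lra.
  rewrite rt => hle.
  have : t * cabs (1 + z) ^+ 2 <= m / 2 by rewrite -tM ler_pM2l.
  have := sqr_ge0 (cabs (1 + z)).
  by nra.
have Qk k : exists s, Q s (r ^+ (2 ^ k)).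
  elim: k => [|k [s hs]]; last first.
    have q01 : 0 <= r ^+ (2 ^ k) < 1; last first.
      by have [s' hs'] := Qs s _ q01 hs; exists s'; rewrite expnSr exprM.
    rewrite exprn_ge0 // exprn_ilt1 //.
    by rewrite -lt0n expn_gt0.
  exists h; rewrite expr1; split=> // x Yx; have e1 := hre x Yx; split=> h0.
    by apply: base; [exact: hM|move: e1; rewrite gtr0_norm].
  have := @base (- h x); rewrite opprK cabsN ReN; apply; first exact: hM.
  by move: e1; rewrite ltr0_norm.
(* If [q <= 1/2] and [q <= d/4], then [|1 - z| (1 - q) <= 2q] yields [|1 - z| <= 4q <= d]. *)
have d'0 : 0 < Num.min (d / 4) (1 / 2) by rewrite lt_min; apply/andP; split; lra.
have [n hn] := expr_small r01 d'0.
have [s hQ] := Qk n; have [hs hx] := hQ.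
set q := r ^+ (2 ^ n) in hx hQ.
have q01 : 0 <= q <= r ^+ n.
  rewrite exprn_ge0 //= ler_wiXn2l // ?(ltW r1) //.
  by rewrite ltnW // ltn_expl.
move: hn; rewrite lt_min => /andP[n1 n2].
have q1 : 0 <= q < 1 by case/andP: q01 => *; apply/andP; split; lra.
have fin z : cabs (1 - z) * (1 - q) <= 2 * q -> cabs (1 - z) <= d.
  by have := cabs_ge0 (1 - z); case/andP: q01 => *; nra.
exists s => // x Yx; split=> h0.
  by have [_ _ /fin] := cabs_near1 q1 ((hx x Yx).1 h0).
have [_ _ /fin] := cabs_near1 q1 (QN _ _ _ hQ Yx h0).
by rewrite opprK.
Qed.

(** For [s] close to the sign of [Re h], the function [(1 + s) / 2] is close to the indicator of
    [Re h > 0]. This does the work of Runge's theorem on two separated half-planes. *)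
Lemma inPX_step (R : realType) N (Y : set (Cn R N)) h (eta d : R) : compact Y ->
  0 < eta -> 0 < d -> inPX Y h -> (forall x, Y x -> eta <= `|complex.Re (h x)|) ->
  exists2 p, is_poly p & forall x, Y x ->
    (0 < complex.Re (h x) -> cabs (1 - p x) <= d) /\
    (complex.Re (h x) < 0 -> cabs (p x) <= d).
Proof.
move=> cY eta0 d0 hh hre; have d2 : 0 < d / 2 by lra.
have [s hs sP] := inPX_sign cY eta0 d0 hh hre.
have hp : inPX Y (fun x => (1 + s x) / 2).
  by apply: inPXM => //; [apply: inPXD => //; exact: inPX_cst|exact: inPX_cst].
have [p [pp hq]] := hp _ d2; exists p => // x Yx.
have := hq x Yx; rewrite cabs_lt => h1; have [sp sn] := sP x Yx.
have half z : cabs (z / 2) = cabs z / 2 :> R.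
  rewrite cabsM cabsV (_ : (2 : CC R) = (2 : R)%:C); last by rewrite rmorph_nat.
  by rewrite cabsR ger0_norm.
split=> [/sp|/sn] h2.
- have -> : 1 - p x = (1 - s x) / 2 + ((1 + s x) / 2 - p x) by field.
  by apply: le_trans (cabsD _ _) _; rewrite half; lra.
- have -> : p x = (1 + s x) / 2 - ((1 + s x) / 2 - p x) by field.
  by apply: le_trans (cabsB _ _) _; rewrite half; lra.
Qed.

(** * Maximum principle *)

(** The disc lies in the square [[-L, L]^2], whose compactness, in near-covering form with the bound
    [c] tending to infinity, makes the local bounds uniform. *)
Lemma locally_bounded_square (R : realType) (m : CC R -> R) (L : R) :
  (forall a, exists d c, 0 < d /\ forall b, cabs (b - a) <= d -> m b <= c) ->
  exists M, forall a : CC R, cabs a <= L -> m a <= M.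
Proof.
move=> loc.
have cS : compact (`[-L, L] `*` `[-L, L] : set (R * R)).
  by apply: compact_setX; exact: segment_compact.
have := (compact_near_coveringP _).1 cS R (pinfty_nbhs R)
  (fun c x => m ((x.1 +i* x.2)%C : CC R) <= c) _.
case=> [[a b] _|M [_ hM]].
  have [d [c [d0 hc]]] := loc (a +i* b)%C.
  have d2 : 0 < d / 2 by lra.
  exists (ball a (d / 2) `*` ball b (d / 2), [set c' | c < c']).
    split; last by exists c; split; rewrite ?num_real.
    by exists (ball a (d / 2), ball b (d / 2)); [split; exact: nbhsx_ballx|].
  move=> [[x y] c'] [[/= xa yb] cc'].
  apply: le_trans (ltW cc'); apply: hc.
  have -> : ((x +i* y)%C : CC R) - (a +i* b)%C = (x - a)%:C + 'i * (y - b)%:C.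
    by apply/eqP; rewrite eq_complex /=; apply/andP; split; apply/eqP; ring.
  apply: le_trans (cabsD _ _) _; rewrite cabsM cabsi mul1r !cabsR.
  by move: xa yb; rewrite /ball /= -(distrC x) -(distrC y); lra.
exists (M + 1) => a aL; have Ma : M < M + 1 by lra.
have := hM _ Ma (complex.Re a, complex.Im a); rewrite /= -[X in m X <= _]/(_ : CC R).
have -> : (complex.Re a +i* complex.Im a)%C = a by case: (a).
apply; have := sqr_cabs a; have := cabs_ge0 a => a0 a2.
have sq (y : R) : y ^+ 2 <= cabs a ^+ 2 -> y \in `[-L, L]%R.
  move=> h; have : `|y| <= L.
    apply: le_trans aL; rewrite -(@ler_pXn2r _ 2%N) ?nnegrE //.
    by rewrite -normrX ger0_norm ?sqr_ge0.
  by rewrite in_itv /= ler_norml.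
by split; apply: sq; rewrite a2 ?lerDl ?lerDr sqr_ge0.
Qed.

(** Strict subharmonicity of [|.|^2]: the four-point mean gains exactly [t^2]. *)
Lemma cabs_4points (R : realType) (a : CC R) (t : R) :
  cabs (a + t%:C) ^+ 2 + cabs (a - t%:C) ^+ 2 +
  cabs (a + t%:C * 'i) ^+ 2 + cabs (a - t%:C * 'i) ^+ 2 =
  4 * (cabs a ^+ 2 + t ^+ 2).
Proof. by rewrite !sqr_cabs; case: a => x y /=; ring. Qed.

(* Maximum principle: m + eps |.|^2 would be strictly below its four-point
   mean at a near-maximum point, the defect t^4 M^5 being o(t^2). *)
Lemma no_submean_function (R : realType) (m : CC R -> R) (A : R) : 1 <= A ->
  (forall a, exists d c, 0 < d /\ forall b, cabs (b - a) <= d -> m b <= c) ->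
  (forall a, 4 * A <= cabs a -> m a <= (2 * A)^-1) ->
  A^-1 <= m 0 ->
  (forall a (t M : R), 0 < t -> 0 < M -> m a < M ->
     m (a + t%:C) < M -> m (a - t%:C) < M ->
     m (a + t%:C * 'i) < M -> m (a - t%:C * 'i) < M ->
     m a <= (m (a + t%:C) + m (a - t%:C) + m (a + t%:C * 'i) + m (a - t%:C * 'i)) / 4
            + t ^+ 4 * M ^+ 5) ->
  False.
Proof.
move=> A1 loc far m0 mean.
pose L := 4 * A + 1; have [M' hM'] := locally_bounded_square L loc.
pose M := Num.max M' 0 + 1.
have M0 : 0 < M by rewrite ltr_wpDl // le_max lexx orbT.
have hM a : cabs a <= L -> m a < M.
  by move=> /hM' h; apply: le_lt_trans h _; rewrite ltr_pwDr // le_max lexx.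
have A0 : 0 < A by lra.
have L0 : 0 < L by rewrite /L; lra.
have iA0 : 0 < A^-1 by rewrite invr_gt0.
(* The perturbation is at most [1/(4A)] on the disc of radius [L], so for [|a| >= 4A] in that disc
   [psi a <= 3/(4A)], well below [psi 0 >= 1/A]. *)
have [e e0 eL] : exists2 e, 0 < e & e * L ^+ 2 = A^-1 / 4.
  exists (A^-1 / 4 / L ^+ 2); first by rewrite !divr_gt0 // exprn_gt0.
  by rewrite mulfVK // expf_neq0 // lt0r_neq0.
pose psi a := m a + e * cabs a ^+ 2.
pose E := [set psi a | a in [set a : CC R | cabs a <= L]].
have psi_ub a : cabs a <= L -> psi a <= M + A^-1 / 4.
  move=> aL; rewrite -eL lerD ?(ltW (hM _ aL)) // ler_pM2l //.
  by rewrite lerXn2r ?nnegrE ?cabs_ge0 // ltW.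
have supE : has_sup E.
  split; first by exists (psi 0), 0 => //=; rewrite cabs0 ltW.
  by exists (M + A^-1 / 4) => _ [a aL <-]; exact: psi_ub.
have Eub a : cabs a <= L -> psi a <= sup E.
  by move=> aL; apply: sup_upper_bound => //; exists a.
(* The defect [t^4 M^5] becomes at most [e t^2 / 2], half the gain from [e |.|^2]. *)
have [t [t0 t1 tM]] : exists t : R, [/\ 0 < t, t <= 1 & t ^+ 2 * M ^+ 5 <= e / 2].
  pose s := Num.min 1 (e / 2 / M ^+ 5).
  have M5 : 0 < M ^+ 5 by rewrite exprn_gt0.
  have s0 : 0 < s by rewrite lt_min ltr01 !divr_gt0.
  have s1 : s <= 1 by rewrite ge_min lexx.
  have sM : s * M ^+ 5 <= e / 2 by rewrite -ler_pdivlMr // ge_min lexx orbT.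
  by exists s; split=> //; apply: le_trans sM; rewrite ler_pM2r // expr2; nra.
(* The supremum may not be attained, so [a] is a near-maximum. The bound [1/(8A)] keeps
   [|a| <= 4A = L - 1], so that the four points, at distance [t <= 1], stay in the disc; [e t^2 / 8]
   is below the net gain [e t^2 / 2]. *)
pose tau := Num.min (e * t ^+ 2 / 8) (A^-1 / 8).
have tau0 : 0 < tau by rewrite lt_min !divr_gt0 ?mulr_gt0 ?exprn_gt0.
have tau1 : tau <= e * t ^+ 2 / 8 by rewrite ge_min lexx.
have tau2 : tau <= A^-1 / 8 by rewrite ge_min lexx orbT.
have [_ [a aL <-] ha] := sup_adherent tau0 supE.
have psi0 : A^-1 <= sup E.
  apply: le_trans (Eub 0 _); last by rewrite cabs0 ltW.
  by rewrite /psi cabs0 expr0n mulr0 addr0.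
have aL1 : cabs a <= L - 1.
  rewrite leNgt; apply/negP => h.
  have h4 : 4 * A <= cabs a by move: h; rewrite /L; lra.
  have := far _ h4; rewrite invfM => hm.
  have : e * cabs a ^+ 2 <= A^-1 / 4.
    by rewrite -eL ler_pM2l // lerXn2r ?nnegrE ?cabs_ge0 // ltW.
  by move: ha; rewrite /psi; lra.
have near b : cabs b = t -> cabs (a + b) <= L.
  by move=> bt; apply: le_trans (cabsD _ _) _; rewrite bt; lra.
have ct : cabs (t%:C : CC R) = t by rewrite cabsR gtr0_norm.
have cti : cabs (t%:C * 'i : CC R) = t by rewrite cabsM ct cabsi mulr1.
have n1 := near _ ct; have n3 := near _ cti.
have n2 : cabs (a - t%:C) <= L by apply: near; rewrite cabsN.
have n4 : cabs (a - t%:C * 'i) <= L by apply: near; rewrite cabsN.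
have := mean a t M t0 M0 (hM _ aL) (hM _ n1) (hM _ n2) (hM _ n3) (hM _ n4).
have := Eub _ n1; have := Eub _ n2; have := Eub _ n3; have := Eub _ n4.
have := cabs_4points a t; move: ha; rewrite /psi.
set u1 := cabs (a + _) ^+ 2; set u2 := cabs (a - _) ^+ 2.
set u3 := cabs (a + _ * 'i) ^+ 2; set u4 := cabs (a - _ * 'i) ^+ 2.
set u := cabs a ^+ 2 => ha hu p4 p3 p2 p1 hm.
have hd : t ^+ 4 * M ^+ 5 <= t ^+ 2 * (e / 2).
  rewrite (_ : t ^+ 4 = t ^+ 2 * t ^+ 2); last by rewrite -exprD.
  by rewrite -mulrA ler_pM2l // exprn_gt0.
have t2 : 0 < t ^+ 2 by rewrite exprn_gt0.
have hu' : e * u1 + e * u2 + e * u3 + e * u4 = 4 * (e * u) + 4 * (e * t ^+ 2).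
  by rewrite -!mulrDr hu; ring.
have et : 0 < e * t ^+ 2 by rewrite mulr_gt0.
have hd' : t ^+ 2 * (e / 2) = e * t ^+ 2 / 2 by ring.
by lra.
Qed.

(** * Ideals of P(Y) and Gelfand theory *)

(** Elements of P(Y) are represented by functions on all of C^N; the last clause makes membership
    depend on the values on [Y] only. *)
Definition PX_ideal (R : realType) N (Y : set (Cn R N))
    (J : (Cn R N -> CC R) -> Prop) : Prop :=
  [/\ J (fun=> 0), forall f, J f -> inPX Y f,
      forall f g, J f -> J g -> J (fun x => f x + g x),
      forall f g, J f -> inPX Y g -> J (fun x => f x * g x) &
      forall f g, J f -> (forall x, Y x -> f x = g x) -> J g].

Definition ideal_adjoin (R : realType) N (Y : set (Cn R N))
    (J : (Cn R N -> CC R) -> Prop) (w : Cn R N -> CC R) : (Cn R N -> CC R) -> Prop :=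
  fun f => exists j g, [/\ J j, inPX Y g & forall x, Y x -> f x = j x + w x * g x].

Lemma ideal_adjoinP (R : realType) N (Y : set (Cn R N)) J w : compact Y ->
  PX_ideal Y J -> inPX Y w -> PX_ideal Y (ideal_adjoin Y J w).
Proof.
move=> cY [J0 JP JD JM JE] hw; split.
- exists (fun=> 0), (fun=> 0); split=> //; first exact: inPX_cst.
  by move=> x _; rewrite mulr0 addr0.
- move=> f [j [g [Jj hg e]]].
  have h : inPX Y (fun x => j x + w x * g x).
    by apply: inPXD; [exact: JP|exact: inPXM].
  by apply: inPX_ext h _ => x Yx; rewrite e.
- move=> f f' [j [g [Jj hg e]]] [j' [g' [Jj' hg' e']]].
  exists (fun x => j x + j' x), (fun x => g x + g' x).
  split; [exact: JD|exact: inPXD|move=> x Yx].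
  by rewrite e // e' //; ring.
- move=> f h [j [g [Jj hg e]]] hh.
  exists (fun x => j x * h x), (fun x => g x * h x).
  split; [exact: JM|exact: inPXM|move=> x Yx].
  by rewrite e //; ring.
- move=> f f' [j [g [Jj hg e]]] ff'; exists j, g; split=> // x Yx.
  by rewrite -ff' // e.
Qed.

Lemma ideal_adjoin_sub (R : realType) N (Y : set (Cn R N)) J w f :
  J f -> ideal_adjoin Y J w f.
Proof.
move=> Jf; exists f, (fun=> 0); split=> //; first exact: inPX_cst.
by move=> x _; rewrite mulr0 addr0.
Qed.

Lemma ideal_adjoin_mem (R : realType) N (Y : set (Cn R N)) J w :
  PX_ideal Y J -> ideal_adjoin Y J w w.
Proof.
move=> [J0 _ _ _ _]; exists (fun=> 0), (fun=> 1); split=> //; first exact: inPX_cst.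
by move=> x _; rewrite mulr1 add0r.
Qed.

(* c is an upper bound for the norm of f in the quotient P(Y)/J. *)
Definition qbound (R : realType) N (Y : set (Cn R N))
    (J : (Cn R N -> CC R) -> Prop) (f : Cn R N -> CC R) : set R :=
  [set c : R | 0 <= c /\ exists2 j, J j & forall x, Y x -> cabs (f x - j x) <= c].

(** An element of [J] at distance less than 1 from the constant 1 would be invertible in P(Y), which
    puts 1 in [J]. *)
Lemma qbound1 (R : realType) N (Y : set (Cn R N)) J (c : R) :
  compact Y -> PX_ideal Y J -> ~ J (fun=> 1) -> qbound Y J (fun=> 1) c -> 1 <= c.
Proof.
move=> cY [J0 JP JD JM JE] nJ [_ [j Jj hr]].
rewrite leNgt; apply/negP => r1; apply: nJ.
have hV := inPXV_near1 cY r1 (JP _ Jj) hr.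
apply: JE (JM _ _ Jj hV) _ => x Yx; rewrite mulfV // -cabs_gt0.
by have := hr x Yx; have := cabsD (1 - j x) (j x); rewrite subrK cabs1; lra.
Qed.

Lemma qboundW (R : realType) N (Y : set (Cn R N)) J f (c d : R) :
  qbound Y J f c -> c <= d -> qbound Y J f d.
Proof.
move=> [c0 [j Jj h]] cd; split; first exact: le_trans cd.
by exists j => // x Yx; apply: le_trans cd; exact: h.
Qed.

Lemma qboundD (R : realType) N (Y : set (Cn R N)) J f g (c d : R) :
  PX_ideal Y J -> qbound Y J f c -> qbound Y J g d ->
  qbound Y J (fun x => f x + g x) (c + d).
Proof.
move=> [J0 JP JD JM JE] [c0 [j Jj h]] [d0 [j' Jj' h']]; split; first exact: addr_ge0.
exists (fun x => j x + j' x); first exact: JD.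
move=> x Yx; have -> : f x + g x - (j x + j' x) = (f x - j x) + (g x - j' x) by ring.
by apply: le_trans (cabsD _ _) _; rewrite lerD ?h ?h'.
Qed.

Lemma qboundM (R : realType) N (Y : set (Cn R N)) J f g (c d : R) :
  PX_ideal Y J -> inPX Y f -> inPX Y g -> qbound Y J f c -> qbound Y J g d ->
  qbound Y J (fun x => f x * g x) (c * d).
Proof.
move=> [J0 JP JD JM JE] hf hg [c0 [j Jj h]] [d0 [j' Jj' h']].
split; first exact: mulr_ge0.
exists (fun x => j x * g x + j' x * (f x - j x)).
  by apply: JD; apply: JM => //; apply: inPXB => //; exact: JP.
move=> x Yx.
have -> : f x * g x - (j x * g x + j' x * (f x - j x)) = (f x - j x) * (g x - j' x) by ring.
by rewrite cabsM ler_pM ?cabs_ge0 ?h ?h'.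
Qed.

Lemma qbound_sup (R : realType) N (Y : set (Cn R N)) J f (c : R) :
  PX_ideal Y J -> 0 <= c -> (forall x, Y x -> cabs (f x) <= c) -> qbound Y J f c.
Proof.
move=> [J0 _ _ _ _] c0 h; split=> //; exists (fun=> 0) => // x Yx.
by rewrite subr0 h.
Qed.

Lemma qbound_cst (R : realType) N (Y : set (Cn R N)) J (a : CC R) :
  PX_ideal Y J -> qbound Y J (fun=> a) (cabs a).
Proof. by move=> hJ; apply: qbound_sup => //; exact: cabs_ge0. Qed.

Lemma qbound_mod (R : realType) N (Y : set (Cn R N)) J f g j (c : R) :
  PX_ideal Y J -> J j -> (forall x, Y x -> g x = f x + j x) ->
  qbound Y J f c -> qbound Y J g c.
Proof.
move=> [J0 JP JD JM JE] Jj e [c0 [j' Jj' h]]; split=> //.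
exists (fun x => j' x + j x) => [|x Yx]; first exact: JD.
have -> : g x - (j' x + j x) = f x - j' x by rewrite e //; ring.
exact: h.
Qed.

Definition qnorm (R : realType) N (Y : set (Cn R N))
    (J : (Cn R N -> CC R) -> Prop) (f : Cn R N -> CC R) : R :=
  inf (qbound Y J f).

Lemma qbound_lbound (R : realType) N (Y : set (Cn R N)) J f :
  has_lbound (qbound Y J f).
Proof. by exists 0 => c []. Qed.

Lemma qnorm_le (R : realType) N (Y : set (Cn R N)) J f c :
  qbound Y J f c -> qnorm Y J f <= c.
Proof. by move=> h; apply: ge_inf => //; exact: qbound_lbound. Qed.

Lemma qbound_gt (R : realType) N (Y : set (Cn R N)) J f c : compact Y ->
  PX_ideal Y J -> inPX Y f -> qnorm Y J f < c -> qbound Y J f c.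
Proof.
move=> cY hJ hf h; have [M M0 hM] := inPX_bounded cY hf.
have ne : qbound Y J f !=set0 by exists M; exact: qbound_sup.
by have [d hd /ltW] := inf_lt ne h; exact: qboundW.
Qed.

(* Gelfand-Mazur: otherwise m a, the quotient norm of the inverse of z - a,
   contradicts the maximum principle. *)
Lemma spectrum_nonempty (R : realType) N (Y : set (Cn R N)) J z : compact Y ->
  PX_ideal Y J -> ~ J (fun=> 1) -> inPX Y z ->
  exists a : CC R, ~ ideal_adjoin Y J (fun x => z x - a) (fun=> 1).
Proof.
move=> cY hJ nJ hz; apply: contrapT => /forallNP hall.
have [J0 JP JD JM JE] := hJ.
have {hall} /choice[rv rvP] (a : CC R) :
    exists g, inPX Y g /\ exists2 j, J j & forall x, Y x -> (z x - a) * g x = 1 + j x.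
  have /contrapT[j [g [Jj hg e]]] := hall a; exists g; split=> //.
  exists (fun x => j x * -1); first by apply: JM => //; exact: inPX_cst.
  by move=> x Yx; apply: (addrI (j x)); rewrite -e //; ring.
have hrv a : inPX Y (rv a) by have [] := rvP a.
pose m a := qnorm Y J (rv a).
have qm a e : 0 < e -> qbound Y J (rv a) (m a + e).
  by move=> e0; apply: qbound_gt => //; rewrite -/(m a); lra.
have m_ge0 a : 0 <= m a.
  apply: lb_le_inf; last by move=> c [].
  by exists (m a + 1); exact: qm.
have [A' A'0 hA'] := inPX_bounded cY hz.
pose A := A' + 1; have A1 : 1 <= A by rewrite /A; lra.
have hA : qbound Y J z A.
  by apply: qbound_sup => // [|x /hA'] => *; rewrite /A; lra.
apply: (@no_submean_function R m A A1).
(* Local bound from the resolvent identity [rv b = rv a + (b - a) * rv a * rv b] modulo [J]: for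
   [|b - a| <= 1/(2c)] it gives [m b <= c + (m b + 1)/2]. *)
- move=> a; pose c := m a + 1.
  have c0 : 0 < c by rewrite /c; have := m_ge0 a; lra.
  exists (2 * c)^-1, (2 * c + 2); split; first by rewrite invr_gt0 mulr_gt0.
  move=> b ba; have [_ [ja Jja ea]] := rvP a; have [_ [jb Jjb eb]] := rvP b.
  have qa : qbound Y J (rv a) c by exact: qm.
  have qb : qbound Y J (rv b) (m b + 1) by exact: qm.
  have qab := qboundM hJ (hrv _) (hrv _) qa qb.
  have qd := qboundM hJ (inPX_cst _ _) (inPXM cY (hrv a) (hrv b)) (qbound_cst (b - a) hJ) qab.
  have Jj : J (fun x => jb x * rv a x + (ja x * rv b x) * -1).
    exact: JD _ _ (JM _ _ Jjb (hrv a)) (JM _ _ (JM _ _ Jja (hrv b)) (inPX_cst _ _)).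
  have hmb : m b <= c + cabs (b - a) * (c * (m b + 1)).
    apply: qnorm_le; apply: (qbound_mod hJ Jj _ (qboundD hJ qa qd)) => x Yx.
    have -> : jb x = (z x - b) * rv b x - 1 by rewrite eb //; ring.
    have -> : ja x = (z x - a) * rv a x - 1 by rewrite ea //; ring.
    by ring.
  have : cabs (b - a) * (c * (m b + 1)) <= (2 * c)^-1 * (c * (m b + 1)).
    by rewrite ler_wpM2r // mulr_ge0 ?ltW // ltr_wpDl.
  rewrite (_ : (2 * c)^-1 * (c * (m b + 1)) = (m b + 1) / 2); last by field; lra.
  by lra.
(* Decay at infinity from [rv a = a^-1 * (z * rv a - 1)] modulo [J]: [|a| m a <= A m a + 3/2], with
   [|a| >= 4A]. *)
- move=> a aA; have [_ [j Jj ej]] := rvP a.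
  have a0 : a != 0 by rewrite -cabs_gt0; lra.
  have e0 : 0 < (2 * A)^-1 by rewrite invr_gt0; lra.
  have q1 := qboundD hJ (qboundM hJ hz (hrv a) hA (qm a _ e0)) (qbound_cst (-1) hJ).
  have h1 : inPX Y (fun x => z x * rv a x + -1).
    by apply: inPXD; [exact: inPXM|exact: inPX_cst].
  have q2 := qboundM hJ (inPX_cst _ _) h1 (qbound_cst a^-1 hJ) q1.
  have Jj' : J (fun x => j x * - a^-1) by apply: JM => //; exact: inPX_cst.
  have hm : m a <= cabs a^-1 * (A * (m a + (2 * A)^-1) + cabs (-1)).
    apply: qnorm_le; apply: (qbound_mod hJ Jj' _ q2) => x Yx.
    have -> : j x = (z x - a) * rv a x - 1 by rewrite ej //; ring.
    by field.
  move: hm; rewrite cabsV cabsN cabs1 mulrC ler_pdivlMr ?cabs_gt0 //.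
  have -> : A * (m a + (2 * A)^-1) = A * m a + 1 / 2 by field; lra.
  have := m_ge0 a => m0 hm.
  have : m a * (4 * A) <= m a * cabs a by rewrite ler_wpM2l.
  rewrite -[(2 * A)^-1]mul1r ler_pdivlMr; last by lra.
  by nra.
- have [_ [j Jj ej]] := rvP 0.
  apply/ler_addgt0Pr => e e0.
  have q1 := qboundM hJ hz (hrv 0) hA (qm 0 _ e0).
  have Jj' : J (fun x => j x * -1) by apply: JM => //; exact: inPX_cst.
  have : 1 <= A * (m 0 + e).
    apply: (qbound1 cY hJ nJ); apply: (qbound_mod hJ Jj' _ q1) => x Yx.
    have -> : j x = (z x - 0) * rv 0 x - 1 by rewrite ej //; ring.
    by ring.
  by rewrite -[A^-1]mul1r ler_pdivrMr 1?mulrC //; lra.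
(* Partial fractions: with [u = z - a] and [b] over the four numbers [t, -t, it, -it], [1/u] is the
   mean of the [1/(u - b)] minus [t^4 / (u (u^4 - t^4))]. The last term is [t^4] times a product of
   five resolvents, whence [M^5]. *)
- move=> a t M t0 M0 ma m1 m2 m3 m4.
  pose tt : CC R := t%:C.
  pose ti : CC R := t%:C * 'i.
  have ti2 : ti ^+ 2 = - tt ^+ 2.
    by rewrite /ti exprMn sqr_i mulrN1.
  rewrite -/tt -/ti in m1 m2 m3 m4 *.
  pose unitJ f := inPX Y f /\ J (fun x => f x - 1).
  have unitM f g : unitJ f -> unitJ g -> unitJ (fun x => f x * g x).
    move=> [hf Jf] [hg Jg]; split; first exact: inPXM.
    apply: JE (JD _ _ (JM _ _ Jf hg) Jg) _ => x _; ring.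
  have unit_rv b : unitJ (fun x => (z x - b) * rv b x).
    split; first by apply: inPXM => //; apply: inPXB => //; exact: inPX_cst.
    by have [_ [j Jj ej]] := rvP b; apply: JE Jj _ => x Yx; rewrite ej //; ring.
  have u0 := unit_rv a; have u1 := unit_rv (a + tt); have u2 := unit_rv (a - tt).
  have u3 := unit_rv (a + ti); have u4 := unit_rv (a - ti).
  (* Products of four factors [(z - b) * rv b], each 1 modulo [J], bring the five resolvents to a
     common denominator. *)
  have J0' := (unitM _ _ u1 (unitM _ _ u2 (unitM _ _ u3 u4))).2.
  have J1' := (unitM _ _ u0 (unitM _ _ u2 (unitM _ _ u3 u4))).2.
  have J2' := (unitM _ _ u0 (unitM _ _ u1 (unitM _ _ u3 u4))).2.
  have J3' := (unitM _ _ u0 (unitM _ _ u1 (unitM _ _ u2 u4))).2.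
  have J4' := (unitM _ _ u0 (unitM _ _ u1 (unitM _ _ u2 u3))).2.
  have hM4 b c : inPX Y (fun x => c * rv b x) by apply: inPXM => //; exact: inPX_cst.
  have JJ := JD _ _ (JM _ _ J0' (hM4 a (-1))) (JD _ _ (JM _ _ J1' (hM4 (a + tt) (1 / 4)))
    (JD _ _ (JM _ _ J2' (hM4 (a - tt) (1 / 4)))
    (JD _ _ (JM _ _ J3' (hM4 (a + ti) (1 / 4))) (JM _ _ J4' (hM4 (a - ti) (1 / 4)))))).
  apply/ler_addgt0Pr => e e0.
  have Q b := qm b _ e0.
  have QM b : m b < M -> qbound Y J (rv b) M by move=> hb; apply: qbound_gt.
  have qs := qboundD hJ (qboundD hJ (qboundD hJ (Q (a + tt)) (Q (a - tt)))
    (Q (a + ti))) (Q (a - ti)).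
  have hs : inPX Y (fun x => rv (a + tt) x + rv (a - tt) x + rv (a + ti) x + rv (a - ti) x).
    by do 3! apply: inPXD => //.
  have qs4 := qboundM hJ (inPX_cst _ _) hs (qbound_cst ((1 / 4 : R)%:C) hJ) qs.
  have h34 := inPXM cY (hrv (a + ti)) (hrv (a - ti)).
  have h234 := inPXM cY (hrv (a - tt)) h34.
  have h1234 := inPXM cY (hrv (a + tt)) h234.
  have h01234 := inPXM cY (hrv a) h1234.
  have qp := qboundM hJ (hrv a) h1234 (QM _ ma)
    (qboundM hJ (hrv _) h234 (QM _ m1) (qboundM hJ (hrv _) h34 (QM _ m2)
    (qboundM hJ (hrv _) (hrv _) (QM _ m3) (QM _ m4)))).
  have qp4 := qboundM hJ (inPX_cst _ _) h01234 (qbound_cst (- tt ^+ 4) hJ) qp.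
  have hm := qnorm_le (qbound_mod (g := rv a) hJ JJ _ (qboundD hJ qs4 qp4)).
  apply: (le_trans (hm _)) => [x Yx|].
    have h14 : ((1 / 4 : R)%:C : CC R) = 1 / 4 by rewrite rmorphM fmorphV rmorph1 rmorph_nat.
    rewrite h14.
    pose P := rv (a + tt) x * rv (a - tt) x * rv (a + ti) x * rv (a - ti) x.
    (* [field] does not know that [i^2 = -1]; the added term isolates this as the vanishing factor
       [ti^2 + tt^2]. *)
    transitivity (rv a x + rv a x * P * (ti ^+ 2 + tt ^+ 2) * ((z x - a) ^+ 2 / 2 - tt ^+ 2)).
      by rewrite ti2 addNr mulr0 mul0r addr0.
    by rewrite /P; field.
  rewrite cabsN cabsX /tt !cabsR !ger0_norm ?(ltW t0) //.
  rewrite (_ : M * (M * (M * (M * M))) = M ^+ 5); last by ring.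
  by lra.
Qed.

(** * Common zeros of proper ideals, and inverses of polynomials *)

Lemma phull_strict (R : realType) N (K : set (Cn R N)) a q : compact K ->
  is_poly q -> (forall x, K x -> cabs (q x) < cabs (q a)) ->
  exists2 r, r < 1 & forall x, K x -> cabs (q x) <= r * cabs (q a).
Proof.
move=> cK pq h.
have [->|/set0P[y Ky]] := eqVneq K set0; first by exists 0.
have [|c Kc hc] := compact_EVT_max (ex_intro _ y Ky) cK (f := fun x => cabs (q x)).
  by apply: continuous_subspaceT; exact/continuous_cabs/is_poly_continuous.
rewrite inE in Kc; have h1 := h c Kc.
have qa0 : 0 < cabs (q a) by apply: le_lt_trans h1; exact: cabs_ge0.
exists (cabs (q c) / cabs (q a)); first by rewrite ltr_pdivrMr ?mul1r.
by move=> x Kx; rewrite mulfVK ?lt0r_neq0 //; apply: hc; rewrite inE.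
Qed.

Lemma proper_ideal_point (R : realType) N (K : set (Cn R N)) J : compact K ->
  PX_ideal K J -> ~ J (fun=> 1) ->
  exists2 a : Cn R N, phull K a & forall q, is_poly q -> J q -> q a = 0.
Proof.
move=> cK hJ nJ.
have [J' [hJ' nJ' sJ' [a ha]]] : exists J', [/\ PX_ideal K J', ~ J' (fun=> 1),
    forall f, J f -> J' f & exists a : Cn R N, forall i,
      J' (fun x => x ord0 i - a ord0 i)].
  suff : forall n, (n <= N)%N -> exists J', [/\ PX_ideal K J', ~ J' (fun=> 1),
      forall f, J f -> J' f & exists a : Cn R N, forall i : 'I_N, (i < n)%N ->
        J' (fun x => x ord0 i - a ord0 i)].
    move=> /(_ N (leqnn N))[J' [h1 h2 h3 [a ha]]]; exists J'; split=> //.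
    by exists a => i; exact: ha.
  elim=> [_|n IH nN].
    by exists J; split=> //; exists 0.
  have [J' [h1 h2 h3 [a ha]]] := IH (ltnW nN).
  pose k := Ordinal nN.
  have hz : inPX K (fun x => x ord0 k) by exact/inPX_poly/poly_coord.
  have [b hb] := spectrum_nonempty cK h1 h2 hz.
  have hw : inPX K (fun x => x ord0 k - b) by apply: inPXB => //; exact: inPX_cst.
  exists (ideal_adjoin K J' (fun x => x ord0 k - b)); split=> //.
  - exact: ideal_adjoinP.
  - by move=> f /h3; exact: ideal_adjoin_sub.
  exists (\row_i (if i == k then b else a ord0 i)) => i.
  rewrite ltnS leq_eqVlt mxE => /orP[/eqP ik|ik].
    have -> : i = k by apply: val_inj.
    by rewrite eqxx; exact: ideal_adjoin_mem.
  rewrite ifN; first exact/ideal_adjoin_sub/ha.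
  by apply/eqP => /(congr1 val) /= e; rewrite e ltnn in ik.
have [J0 JP JD JM JE] := hJ'.
(* Modulo [J'] each coordinate is a constant, hence each polynomial is its value at [a]. *)
have ev q : is_poly q -> J' (fun x => q x - q a).
  elim=> [c|i|p {}q pp Jp pq Jq|p {}q pp Jp pq Jq].
  - by apply: JE J0 _ => x _; rewrite subrr.
  - exact: ha.
  - by apply: JE (JD _ _ Jp Jq) _ => x _; ring.
  - apply: JE (JD _ _ (JM _ _ Jp (inPX_poly K pq)) (JM _ _ Jq (inPX_cst K (p a)))) _.
    by move=> x _; ring.
have unit_cst c : c != 0 -> ~ J' (fun=> c).
  move=> c0 Jc; apply: nJ'.
  by apply: JE (JM _ _ Jc (inPX_cst K c^-1)) _ => x _; rewrite mulfV.
exists a => [q pq|q pq /sJ' Jq].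
  apply: contrapT => /forall2NP h.
  have h' x : K x -> cabs (q x) < cabs (q a).
    by move=> Kx; have [//|/negP] := h x; rewrite cabs_le -ltNge.
  have [r r1 hr] := phull_strict cK pq h'.
  have [qa0|qa0] := eqVneq (q a) 0.
    have [x Kx] : exists x, K x.
      apply: contrapT => /forallNP nK; apply: nJ'; apply: JE J0 _ => x Kx.
      by case: (nK x).
    by have := h' x Kx; rewrite qa0 cabs0 ltNge cabs_ge0.
  (* This element is [1 - q / q a], at distance at most [r < 1] from 1 on [K], which [qbound1]
     forbids. The [Num.max] below supplies the sign that [qbound] requires. *)
  have Jn : J' (fun x => (q x - q a) * - (q a)^-1) by apply: JM (ev q pq) _; exact: inPX_cst.
  have : 1 <= Num.max r 0.
    apply: (qbound1 cK hJ' nJ'); split; first by rewrite le_max lexx orbT.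
    exists (fun x => (q x - q a) * - (q a)^-1) => // x Kx.
    rewrite (_ : 1 - _ = q x / q a); last by field.
    rewrite cabsM cabsV ler_pdivrMr ?cabs_gt0 //; apply: le_trans (hr x Kx) _.
    by rewrite ler_wpM2r ?cabs_ge0 // le_max lexx.
  by rewrite le_max leNgt r1 /= ler10.
apply/eqP; apply: contrapT => /negP/unit_cst; apply.
apply: JE (JD _ _ Jq (JM _ _ (ev q pq) (inPX_cst K (-1)))) _ => x _; ring.
Qed.

Lemma poly_inverse_inPX (R : realType) N (K : set (Cn R N)) p : compact K ->
  phull K `<=` K -> is_poly p -> (forall x, K x -> p x != 0) ->
  inPX K (fun x => (p x)^-1).
Proof.
move=> cK hK pp p0; apply: contrapT => nV.
(* [Z] is the zero ideal of P(K); adjoining [p] gives the ideal generated by [p], which contains 1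
   only if [1/p] is in P(K). *)
pose Z f := forall x : Cn R N, K x -> f x = 0 :> CC R.
have hZ : PX_ideal K Z.
  split=> //.
  - by move=> f Zf; apply: inPX_ext (inPX_cst K 0) _ => x Kx; rewrite Zf.
  - by move=> f g Zf Zg x Kx; rewrite Zf // Zg // addr0.
  - by move=> f g Zf _ x Kx; rewrite Zf // mul0r.
  - by move=> f g Zf fg x Kx; rewrite -fg // Zf.
have hp := inPX_poly K pp.
have [a ha /(_ p pp (ideal_adjoin_mem p hZ)) pa] :
    exists2 a, phull K a & forall q, is_poly q -> ideal_adjoin K Z p q -> q a = 0.
  apply: proper_ideal_point => //; first exact: ideal_adjoinP.
  move=> [j [g [Zj hg e]]]; apply: nV; apply: inPX_ext hg _ => x Kx.
  apply: (mulfI (p0 x Kx)); rewrite mulfV ?p0 //.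
  by rewrite (e x Kx) Zj // add0r.
by have := p0 a (hK _ ha); rewrite pa eqxx.
Qed.

(** * A countable dense family of polynomials *)

(** Codes in a countable type, enumerated by [pickle], for polynomials over Q(i): on two subtrees
    label 0 is a sum and any other label a product; ill-formed nodes count as 0. *)
Fixpoint tree_eval (R : realType) N (t : GenTree.tree (rat * rat + 'I_N))
    (x : Cn R N) : CC R :=
  match t with
  | GenTree.Leaf (inl ab) => (ratr ab.1 +i* ratr ab.2)%C
  | GenTree.Leaf (inr i) => x ord0 i
  | GenTree.Node 0 [:: s; u] => tree_eval s x + tree_eval u x
  | GenTree.Node _ [:: s; u] => tree_eval s x * tree_eval u x
  | _ => 0
  end.

Lemma rat_approx (R : realType) (y e : R) : 0 < e ->
  exists q : rat, `|y - ratr q| <= e.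
Proof.
move=> e0; have ye : y < y + e by lra.
have [q] := rat_in_itvoo ye; rewrite in_itv /= => /andP[h1 h2]; exists q.
by rewrite ler_norml; apply/andP; split; lra.
Qed.

Lemma tree_eval_dense (R : realType) N (Y : set (Cn R N)) q : compact Y ->
  is_poly q -> forall e : R, 0 < e ->
  exists2 t : GenTree.tree (rat * rat + 'I_N), is_poly (tree_eval (R := R) t) &
    forall x, Y x -> cabs (q x - tree_eval t x) <= e.
Proof.
move=> cY; elim=> [[a b]|i|p {}q pp IHp pq IHq|p {}q pp IHp pq IHq] e e0.
- have e2 : 0 < e / 2 by lra.
  have [ra ha] := rat_approx a e2; have [rb hb] := rat_approx b e2.
  exists (GenTree.Leaf (inl (ra, rb))); first exact: poly_const.
  move=> x _ /=.
  have -> : ((a +i* b)%C : CC R) - (ratr ra +i* ratr rb)%C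
    = (a - ratr ra)%:C + 'i * (b - ratr rb)%:C.
    by apply/eqP; rewrite eq_complex /=; apply/andP; split; apply/eqP; ring.
  by apply: le_trans (cabsD _ _) _; rewrite cabsM cabsi mul1r !cabsR; lra.
- exists (GenTree.Leaf (inr i)); first exact: poly_coord.
  by move=> x _; rewrite subrr cabs0 ltW.
- have e2 : 0 < e / 2 by lra.
  have [s ps hs] := IHp _ e2; have [u pu hu] := IHq _ e2.
  exists (GenTree.Node 0 [:: s; u]); first exact: poly_add.
  move=> x Yx /=.
  have -> : p x + q x - (tree_eval s x + tree_eval u x)
    = (p x - tree_eval s x) + (q x - tree_eval u x) by ring.
  by apply: le_trans (cabsD _ _) _; have := hs x Yx; have := hu x Yx; lra.
- have [A A0 hA] := is_poly_bounded cY pp.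
  have [B B0 hB] := is_poly_bounded cY pq.
  have [d d0 hd] := cabs_mul_approx A0 B0 e0.
  have [s ps hs] := IHp _ d0; have [u pu hu] := IHq _ d0.
  exists (GenTree.Node 1 [:: s; u]); first exact: poly_mul.
  by move=> x Yx; apply: hd; [exact: hA|exact: hB|exact: hs|exact: hu].
Qed.

Lemma countable_dense_poly (R : realType) N (Y : set (Cn R N)) : compact Y ->
  exists2 F : nat -> Cn R N -> CC R, forall n, is_poly (F n) &
    forall q, is_poly q -> forall e : R, 0 < e ->
      exists n, forall x, Y x -> cabs (q x - F n x) <= e.
Proof.
move=> cY.
pose F n : Cn R N -> CC R :=
  if unpickle n is Some t then
    if `[< is_poly (tree_eval (R := R) (N := N) t) >] then tree_eval t else fun=> 0
  else fun=> 0.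
exists F => [n|q pq e e0].
  rewrite /F; case: unpickle => [t|]; last exact: poly_const.
  by case: asboolP => // _; exact: poly_const.
have [t pt ht] := tree_eval_dense cY pq e0.
exists (pickle t) => x Yx; rewrite /F pickleK.
by case: asboolP => // _; exact: ht.
Qed.

(** * Construction of X *)

(* {Re H >= 1/2} shrinks to {Re H' >= 1/2}: H' = phi(H) p q with q close to 1/p
   on K and phi(H) close to 1 on K, tiny where Re H <= 1/2 on Sigma. *)
Lemma shrink_step (R : realType) N (Sigma K : set (Cn R N)) H p :
  compact Sigma -> compact K -> phull K `<=` K ->
  is_poly H -> (forall x, K x -> 3 / 4 <= complex.Re (H x)) ->
  is_poly p -> (forall x, K x -> p x != 0) ->
  exists H', [/\ is_poly H', forall x, K x -> 3 / 4 <= complex.Re (H' x),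
    exists2 r, is_poly r & forall x, H' x = p x * r x &
    forall x, Sigma x -> 1 / 2 <= complex.Re (H' x) -> 1 / 2 <= complex.Re (H x)].
Proof.
move=> cS cK hK pH HK pp p0.
have e8 : 0 < 1 / 8 :> R by lra.
have [A A0 hA] := is_poly_bounded cK pp.
have [q [pq hq]] : exists q, is_poly q /\ forall x, K x -> cabs (1 - p x * q x) <= 1 / 8.
  have A8 : 0 < 1 / 8 / (A + 1) by rewrite divr_gt0 //; lra.
  have [q [pq hq]] := poly_inverse_inPX cK hK pp p0 A8.
  exists q; split=> // x Kx; have := hq x Kx; rewrite cabs_lt.
  have -> : 1 - p x * q x = p x * ((p x)^-1 - q x) by rewrite mulrBr mulfV ?p0.
  rewrite cabsM ltr_pdivlMr; last by lra.
  by have := hA x Kx; have := cabs_ge0 (p x); have := cabs_ge0 ((p x)^-1 - q x); nra.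
have ppq : is_poly (fun x => p x * q x) by exact: poly_mul.
have [B1 B10 hB1] := is_poly_bounded cK ppq.
have [B2 B20 hB2] := is_poly_bounded cS ppq.
pose B := B1 + B2 + 1; have B0 : 0 < B by rewrite /B; lra.
have cT : compact (Sigma `&` [set x | complex.Re (H x) <= 1 / 2]).
  apply: compact_closedI => //.
  apply: (@preimage_closed _ _ (fun x => complex.Re (H x)) [set y | y <= 1 / 2]).
    by move=> x _; exact/continuous_Re/is_poly_continuous.
  exact: closed_le.
have cY := compactU cK cT.
(* 5/8 is midway between the bound 3/4 on [K] and 1/2 on the rest, so the shifted real part has
   modulus at least 1/8. Two errors of 1/8 then leave [Re H' >= 3/4] on [K]. *)
have ph : is_poly (fun x => H x + (- (5 / 8 : R))%:C) by apply: poly_add => //; exact: poly_const.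
have d0 : 0 < 1 / 8 / B by rewrite divr_gt0.
have [|phi pphi hphi] := inPX_step cY e8 d0 (inPX_poly _ ph).
  move=> x [Kx|[_ /= Tx]]; rewrite ReD /=.
    by have h := HK x Kx; rewrite ger0_norm; lra.
  by rewrite ler0_norm; lra.
have small (u v : CC R) : cabs u <= 1 / 8 / B -> cabs v <= B -> cabs (u * v) <= 1 / 8.
  move=> hu hv; rewrite cabsM -[1 / 8](divfK (lt0r_neq0 B0)).
  by rewrite ler_pM ?cabs_ge0.
exists (fun x => phi x * (p x * q x)); split.
- exact: poly_mul.
- move=> x Kx; have [h1 _] := hphi x (or_introl Kx).
  have {}h1 : cabs (1 - phi x) <= 1 / 8 / B.
    by apply: h1; rewrite ReD /=; have := HK x Kx; lra.
  have h3 := hq x Kx.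
  have h2 : cabs ((1 - phi x) * (p x * q x)) <= 1 / 8.
    by apply: small => //; apply: le_trans (hB1 x Kx) _; rewrite /B; lra.
  have -> : phi x * (p x * q x) = 1 - ((1 - p x * q x) + (1 - phi x) * (p x * q x)) by ring.
  have := cabsD (1 - p x * q x) ((1 - phi x) * (p x * q x)).
  set s := 1 - p x * q x + _; have := Re_cabs s.
  by rewrite (ReD 1) ReN ler_norml => /andP[_] /=; lra.
- exists (fun x => phi x * q x); first exact: poly_mul.
  by move=> x; ring.
- move=> x Sx; apply: contraTT; rewrite -!ltNge => Hx.
  have [_ h1] : _ /\ _ := hphi x (or_intror (conj Sx (ltW Hx))).
  have {}h1 : cabs (phi x) <= 1 / 8 / B by apply: h1; rewrite ReD /=; lra.
  have h2 : cabs (phi x * (p x * q x)) <= 1 / 8.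
    by apply: small => //; apply: le_trans (hB2 x Sx) _; rewrite /B; lra.
  by have := Re_cabs (phi x * (p x * q x)); rewrite ler_norml => /andP[_]; lra.
Qed.

(* Compare |H + L| at z and on Z for a large constant L. *)
Lemma phull_Re (R : realType) N (Sigma Z : set (Cn R N)) H z : compact Sigma ->
  is_poly H -> Z `<=` Sigma -> phull Z z -> 3 / 4 <= complex.Re (H z) ->
  exists2 x, Z x & 1 / 2 <= complex.Re (H x).
Proof.
move=> cS pH ZS hz Hz; have [M M0 hM] := is_poly_bounded cS pH.
(* If [Re (H x) < 1/2], expanding the squares gives [(3/2) L <= M^2 + L], which fails for this
   [L]. *)
have [L LM] : exists L, L = 2 * M ^+ 2 + 1 by eexists.
have L0 : 0 < L by nra.
have pL : is_poly (fun x => H x + L%:C) by apply: poly_add => //; exact: poly_const.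
have [x Zx] := hz _ pL; rewrite cabs_le => h; exists x => //.
have : cabs (H z + L%:C) ^+ 2 <= cabs (H x + L%:C) ^+ 2.
  by rewrite lerXn2r ?nnegrE ?cabs_ge0.
rewrite !sqr_cabs_addR => h2.
have : cabs (H x) ^+ 2 <= M ^+ 2 by rewrite lerXn2r ?nnegrE ?cabs_ge0 //; exact/hM/ZS.
have := sqr_ge0 (cabs (H z)); move: h2.
set u := cabs (H z) ^+ 2; set v := cabs (H x) ^+ 2 => h2 u0 vM.
rewrite leNgt; apply/negP => hx.
have : 2 * L * complex.Re (H x) <= 2 * L * (1 / 2).
  by rewrite ler_pM2l ?mulr_gt0 // ltW.
have : 2 * L * (3 / 4) <= 2 * L * complex.Re (H z) by rewrite ler_pM2l ?mulr_gt0.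
by lra.
Qed.

(** Finite intersection property: if each point of [Z] left some set [c <= u n], and with it all
    later ones, compactness would give one [n] whose set misses [Z]. *)
Lemma nested_meet (R : realType) (T : topologicalType) (Z : set T) (u : nat -> T -> R)
    (c : R) :
  compact Z -> (forall n, continuous (u n)) ->
  (forall n x, Z x -> c <= u n.+1 x -> c <= u n x) ->
  (forall n, exists2 x, Z x & c <= u n x) ->
  exists2 x, Z x & forall n, c <= u n x.
Proof.
move=> cZ cu dec ne; apply: contrapT => /forall2NP hno.
have decn n k x : Z x -> c <= u (n + k)%N x -> c <= u n x.
  by move=> Zx; elim: k => [|k IH]; rewrite ?addn0 // addnS => /dec-/(_ Zx).
have := (compact_near_coveringP _).1 cZ nat \oo
  (fun n x => Z x -> u n x < c) _.
case=> [x Zx|n _ hn].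
  have [//|/existsNP[n /negP]] := hno x; rewrite -ltNge => un.
  exists ([set y | u n y < c], [set m | (n <= m)%N]).
    split; last by exists n.
    have /cvgrPdist_lt/(_ (c - u n x)) := cu n x; rewrite subr_gt0 => /(_ un).
    by apply: filterS => y /=; rewrite ltr_norml => /andP[]; lra.
  move=> [y m] [/= uy nm] Zy; rewrite ltNge; apply/negP.
  by rewrite -(subnKC nm) => /decn-/(_ Zy); rewrite leNgt uy.
have [x Zx] := ne n; have := hn n (leqnn n) x Zx Zx.
by rewrite ltNge => /negP.
Qed.

Theorem theorem5p2 (R : realType) (N : nat) (Sigma K : set (Cn R N)) (k : nat) :
  (2 <= N)%N ->
  compact Sigma ->
  (2 <= k <= N)%N ->
  compact K ->
  K `<=` khull k Sigma ->
  phull K = K ->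
  (forall f : Cn R N -> CC R, inPX Sigma f ->
     forall e : R, 0 < e ->
       exists p : Cn R N -> CC R, is_poly p /\ (forall z, K z -> p z != 0) /\
         forall x, Sigma x -> `|f x - p x| < e%:C) ->
  exists X : set (Cn R N),
    X `<=` Sigma /\ compact X /\ K `<=` rhull k.-1 X /\ dense_invertibles X.
Proof.
move=> _ cS _ cK hK pcK dens.
have hK' : phull K `<=` K by rewrite pcK.
have [F pF dF] := countable_dense_poly cS.
(* The index codes a pair: [p n] approximates [F i] on [Sigma] within [1/(j + 1)]. Indices that code
   no pair get the constant 1. *)
have /choice[p pP] (n : nat) : exists p : Cn R N -> CC R,
    [/\ is_poly p, forall z, K z -> p z != 0 & forall i j : nat, n = pickle (i, j) ->
      forall x, Sigma x -> cabs (F i x - p x) < j.+1%:R^-1].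
  case e : (unpickle n : option (nat * nat)) => [[i j]|]; last first.
    exists (fun=> 1); split; [exact: poly_const|by move=> *; rewrite oner_eq0|].
    by move=> i j nij; rewrite nij pickleK in e.
  have j0 : 0 < j.+1%:R^-1 :> R by rewrite invr_gt0.
  have [q [pq [q0 hq]]] := dens _ (inPX_poly _ (pF i)) _ j0.
  exists q; split=> // i' j' nij; move: e; rewrite nij pickleK => -[-> ->] x Sx.
  by rewrite -cabs_lt hq.
pose good (H : Cn R N -> CC R) := is_poly H /\ forall x, K x -> 3 / 4 <= complex.Re (H x).
pose next n (H H' : Cn R N -> CC R) := [/\ good H', exists2 r, is_poly r & forall x, H' x = p n x * r x &
    forall x, Sigma x -> 1 / 2 <= complex.Re (H' x) -> 1 / 2 <= complex.Re (H x)].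
have /choice[g gP] (nH : nat * (Cn R N -> CC R)) :
    exists H', good nH.2 -> next nH.1 nH.2 H'.
  case: nH => n H; have [[pH HK]|nH] := pselect (good H); last by exists H.
  have [pp p0 _] := pP n.
  by have [H' [h1 h2 h3 h4]] := shrink_step cS cK hK' pH HK pp p0; exists H'.
pose H := fix H n := if n is n'.+1 then g (n', H n') else fun=> 1.
have goodH n : good (H n).
  elim: n => [|n /(gP (n, _))[]//]; split; first exact: poly_const.
  by move=> x _ /=; lra.
have nextH n : next n (H n) (H n.+1) by exact: (gP (n, H n) (goodH n)).
have cRe n : continuous (fun x => complex.Re (H n x)).
  by apply/continuous_Re/is_poly_continuous; have [] := goodH n.
pose X := Sigma `&` [set x | forall n, 1 / 2 <= complex.Re (H n x)].
have cX : compact X.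
  apply: compact_closedI => //.
  have -> : [set x | forall n, 1 / 2 <= complex.Re (H n x)] =
      \bigcap_n [set x | 1 / 2 <= complex.Re (H n x)].
    by apply/seteqP; split=> x h n; [move=> _|]; exact: h.
  apply: closed_bigI => n _.
  apply: (@preimage_closed _ _ (fun x => complex.Re (H n x)) [set y | 1 / 2 <= y]).
    by move=> x _; exact: cRe.
  exact: closed_ge.
exists X; split; first by move=> x [].
split=> //; split.
  move=> z Kz m V hm pV Vz; have [_ /(_ m V hm pV Vz) hz] := hK z Kz.
  have [[clV _] _] := pV.
  have [n x [Sx _]|n|x [Sx Vx] hx] :=
    @nested_meet R _ (Sigma `&` V) (fun n x => complex.Re (H n x)) (1 / 2)
      (compact_closedI cS clV) cRe.
  - by have [_ _] := nextH n; exact.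
  - have [pH HK] := goodH n.
    by apply: (phull_Re cS pH _ hz); [move=> x []|exact: HK].
  by exists x.
(* [f] is controlled on [X] only, so it is first replaced by a polynomial [q], which [F i] and then
   [p n] approximate on all of [Sigma]. *)
move=> f hf e e0; have e3 : 0 < e / 3 by lra.
have [q [pq hq]] := hf _ e3.
have [i hi] := dF q pq _ e3.
have [j hj] : exists j : nat, j.+1%:R^-1 < e / 3.
  exists (Num.trunc (e / 3)^-1); rewrite invf_plt ?posrE ?ltr0n //.
  exact: truncnS_gt.
pose n := pickle (i, j); have [pp p0 hp] := pP n.
have [[pH _] [r pr Hr] _] := nextH n.
have half0 : 0 < 1 / 2 :> R by lra.
have HX x : X x -> 1 / 2 <= complex.Re (H n.+1 x) by move=> [_ /(_ n.+1)].
have pX x : X x -> p n x != 0.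
  move=> /HX; rewrite Hr => h; apply/eqP => px0.
  by move: h; rewrite px0 mul0r /=; lra.
exists (p n); split; last first.
  move=> x Xx; have [Sx _] := Xx; rewrite cabs_lt.
  have := hq x Xx; rewrite cabs_lt => h1; have h2 := hi x Sx.
  have h3 := lt_trans (hp i j erefl x Sx) hj.
  have -> : f x - p n x = (f x - q x) + ((q x - F i x) + (F i x - p n x)) by ring.
  have := cabsD (f x - q x) ((q x - F i x) + (F i x - p n x)).
  by have := cabsD (q x - F i x) (F i x - p n x); lra.
split; first exact: inPX_poly.
exists (fun x => (p n x)^-1); split; last by move=> x /pX; exact: mulfV.
(* [H n.+1 = p n * r] turns [1 / p n] into [r / H n.+1], and the strip lemma inverts [H n.+1] on
   [X]. *)
have hV : inPX X (fun x => (H n.+1 x)^-1).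
  apply: (inPXV_strip cX half0 (inPX_poly _ pH)) => x /HX h.
  exact: le_trans (ler_norm _).
apply: inPX_ext (inPXM cX hV (inPX_poly X pr)) _ => x Xx.
have := HX x Xx; rewrite Hr => h.
have r0 : r x != 0 by apply/eqP => r0; move: h; rewrite r0 mulr0 /=; lra.
by rewrite invfM -mulrA mulVf // mulr1.
Qed.
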